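(* Let $a, b \in \mathbb{R}$ with $a \notin \{0,1\}$, and suppose the equation $y = ax + b$ has infinitely many distinct solutions $(x,y) \in \mathbb{N} \times \mathbb{N}$. Then for Lebesgue-almost every $\alpha > 1$: if $\alpha < 2$, the equation $y = ax+b$ has infinitely many distinct solutions $(x,y) \in \mathrm{PS}(\alpha) \times \mathrm{PS}(\alpha)$, and if $\alpha > 2$, it has only finitely many such solutions.
   Context: For $\alpha > 1$, $\mathrm{PS}(\alpha) = \{\lfloor n^\alpha \rfloor : n \in \mathbb{N}\}$, where $\lfloor x \rfloor$ denotes the integer part (floor) of $x$. *)

(* Defs.v *)
From HB Require Import structures.
From mathcomp Require Import all_boot all_order all_algebra.
From mathcomp Require Import all_classical all_reals all_analysis.

Set Implicit Arguments.
Unset Strict Implicit.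
Unset Printing Implicit Defensive.

Import Order.TTheory GRing.Theory Num.Theory.
Import numFieldNormedType.Exports.

Local Open Scope classical_set_scope.
Local Open Scope ring_scope.

(* The set N = {1, 2, 3, ...}, inside the integers. *)
Definition posint : set int := [set n%:Z | n in [set n : nat | (0 < n)%N]].

Definition PS (R : realType) (alpha : R) : set int :=
  [set Num.floor (n%:R `^ alpha) | n in [set n : nat | (0 < n)%N]].

Definition line_solutions (R : realType) (a b : R) (A : set int)
    : set (int * int) :=
  [set p | [/\ A p.1, A p.2 & p.2%:~R = a * p.1%:~R + b]].

(* Main.v *)
(* Swapping x and y we may take a > 1; two solutions in the positive integers
   give a residue class of x on which a x + b is an integer. Write
   h(t) = n^t - a m^t; solutions x = floor(m^t), y = floor(n^t) have h(t) = O(1).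

   For t > 2, the set of t in a compact interval of ]2, +oo[ with h(t) = O(1) has
   diameter O(m^-(2+d)) and is empty unless n = O(m), so Borel-Cantelli applies.

   For t < 2, Dirichlet's theorem gives infinitely many (m, n), not necessarily
   coprime, with |a^(1/t) - n/m| <= m^-t, hence h = O(1) at t. The slope of h near t is
   of order m^t, so at distance O(m^-t) of t there is an interval of length at least
   c m^-t on which h is close to b + 1/4. By the Lebesgue density theorem almost every
   t lies in infinitely many such intervals. While t moves by O(1/(m^t ln m)), m^t
   runs through the required residue class whereas h moves by O(1/ln m) only;
   a second application of the density theorem gives infinitely many solutions. *)

Require Import Defs.
From HB Require Import structures.
From mathcomp Require Import all_boot all_order all_algebra.
From mathcomp Require Import all_classical all_reals all_analysis.
From mathcomp Require Import lra ring zify.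

Set Implicit Arguments.
Unset Strict Implicit.
Unset Printing Implicit Defensive.

Import Order.TTheory GRing.Theory Num.Theory.
Import numFieldNormedType.Exports.

Local Open Scope classical_set_scope.
Local Open Scope ring_scope.

(** * Density points and sets with porous complement *)

(* Interiors are used so that nothing need be known about the measurability of [A]. *)
Lemma negligible_porous (R : realType) (S A : set R) : measurable S ->
  (forall x, S x -> exists2 c : R, 0 < c & forall d : R, 0 < d ->
     exists u v r : R, [/\ 0 < r < d, x - r <= u, v <= x + r, c * r <= v - u &
       `]u, v[ `<=` A]) ->
  (@lebesgue_measure R).-negligible (S `\` A°).
Proof.
move=> mS porA; pose B := S `\` A°.
have mA : measurable (A°).
  by apply: measurable_realfun.open_measurable; exact: open_interior.
have mB : measurable B by exact: measurableD.
have := lebesgue_density mB; apply: negligibleS => x /= Bx; rewrite /= => dens.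
have [c c0 por] := porA _ Bx.1.
(* At a density point of [B] the ratio eventually exceeds 1 - c/8. A hole of length at least c r in
   the ball of radius 2r, which has length 4r, keeps it at most 1 - c/4. *)
have lt1 : ((1 - c / 8)%:E < (\1_B x)%:E)%E.
  by rewrite indicE mem_set// lte_fin ltrBlDr ltrDl divr_gt0.
have := dens _ (open_ereal_gt' lt1); rewrite /= => -[e /= e0 He].
have [u [v [r [/andP[r0 re] xu vx cr uvA]]]] := por (e / 2) (divr_gt0 e0 (ltr0Sn _ _)).
have uv : u < v by rewrite -subr_gt0 (lt_le_trans _ cr)// mulr_gt0.
have uvA' : `]u, v[ `<=` A°.
  by rewrite -open_subsetE//; exact: interval_open.
have r20 : 0 < 2 * r by rewrite mulr_gt0.
have r2e : 2 * r < e by rewrite mulrC -ltr_pdivlMr.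
have := He (2 * r); rewrite /ball/= sub0r normrN gtr0_norm//.
move=> /(_ r2e r20); apply/negP; rewrite -leNgt.
have le1 : (lebesgue_measure (B `&` ball x (2 * r)) <= (2 * r *+ 2 - (v - u))%:E)%E.
  have uvb : `]u, v[ `<=` ball x (2 * r).
    move=> y /=; rewrite in_itv/= => /andP[uy yv].
    by rewrite /ball/= ltr_norml; apply/andP; split; lra.
  have -> : (2 * r *+ 2 - (v - u))%:E = lebesgue_measure (ball x (2 * r) `\` `]u, v[).
    rewrite measureD//=; [|exact: measurable_realfun.measurable_ball|]; last first.
      by rewrite lebesgue_measure_ball ?ltry// ltW.
    rewrite (setIidr uvb) lebesgue_measure_ball ?ltW// lebesgue_measure_itv/=.
    by rewrite lte_fin uv -EFinB.
  apply: le_measure; rewrite ?inE/=.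
  - by apply: measurableI => //; exact: measurable_realfun.measurable_ball.
  - by apply: measurableD => //; exact: measurable_realfun.measurable_ball.
  - by move=> y [[_ nAy] by_]; split => // /uvA'.
rewrite lebesgue_measure_ball ?ltW// inver mulrn_eq0/= gt_eqF//=.
have [s sE] : exists s, lebesgue_measure (B `&` ball x (2 * r)) = s%:E.
  exists (fine (lebesgue_measure (B `&` ball x (2 * r)))); rewrite fineK// ge0_fin_numE//.
  by rewrite (le_lt_trans le1)// ltry.
rewrite sE -EFinM lte_fin ltr_pdivrMr; last by rewrite mulrn_wgt0.
by move: le1; rewrite sE lee_fin !mulr2n; nra.
Qed.

(** * The function n^t - a m^t under small changes of the exponent *)

Lemma norm_expR_sub1 (R : realType) (x : R) : `|x| <= 2^-1 ->
  `|expR x - 1| <= 2 * `|x|.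
Proof.
move=> hx; have e1 := expR_ge1Dx x; have e2 := expR_ge1Dx (- x).
have ex0 := expR_gt0 x.
have e3 : expR x * (1 - x) <= 1.
  rewrite -[leRHS](divff (lt0r_neq0 ex0)) -expRN ler_pM2l//.
rewrite ler_norml; move: hx; rewrite ler_norml => /andP[hx1 hx2].
by have [x0|x0] := ger0P x; apply/andP; split; nra.
Qed.

Lemma powRE (R : realType) (x y : R) : 0 < x -> x `^ y = expR (y * ln x).
Proof. by move=> x0; rewrite /powR gt_eqF. Qed.

Section LinearForm.
Context {R : realType}.
Implicit Types a m n t s : R.

(** This is the function h of the introductory comment, with [m] and [n] allowed to be real. *)
Definition powR_form a m n t := n `^ t - a * m `^ t.

Lemma powR_formD a m n t s : 0 < m -> 0 < n ->
  powR_form a m n (t + s) =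
  powR_form a m n t * n `^ s + a * m `^ t * (n `^ s - m `^ s).
Proof.
have powRD' x : 0 < x -> x `^ (t + s) = x `^ t * x `^ s.
  by move=> x0; apply: powRD; apply/implyP; rewrite (gt_eqF x0).
by move=> m0 n0; rewrite /powR_form !powRD'//; ring.
Qed.

Lemma powR_div_expR m n s : 0 < m -> 0 < n ->
  n `^ s = m `^ s * expR (s * (ln n - ln m)).
Proof. by move=> m0 n0; rewrite !powRE// -expRD; congr expR; ring. Qed.

(** The increment splits as h(t) (n^s - 1) + a m^t (n^s - m^s). The factor ln n thus meets only
    h(t), which is O(1) in the applications, while the large factor m^t meets only ln (n / m), which
    stays bounded there. *)
Lemma norm_powR_formB a m n t s : 0 < a -> 1 <= m -> m <= n ->
  `|s| * ln n <= 2^-1 ->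
  `|powR_form a m n (t + s) - powR_form a m n t| <=
  2 * `|s| * (`|powR_form a m n t| * ln n + 2 * a * m `^ t * (ln n - ln m)).
Proof.
move=> a0 m1 mn sn.
have m0 : 0 < m by lra.
have n0 : 0 < n by lra.
have lm0 : 0 <= ln m by rewrite ln_ge0.
have lmn : ln m <= ln n by rewrite ler_ln// posrE.
have mt0 := powR_gt0 t m0.
rewrite powR_formD//.
set h := powR_form a m n t.
have -> : h * n `^ s + a * m `^ t * (n `^ s - m `^ s) - h =
   h * (n `^ s - 1) + a * m `^ t * (n `^ s - m `^ s) by ring.
apply: (le_trans (ler_normD _ _)); rewrite [leRHS]mulrDr; apply: lerD.
  rewrite normrM.
  have -> : 2 * `|s| * (`|h| * ln n) = `|h| * (2 * `|s * ln n|).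
    by rewrite normrM (ger0_norm (_ : 0 <= ln n)) ?(le_trans lm0)//; ring.
  rewrite ler_wpM2l// powRE// norm_expR_sub1// normrM.
  by rewrite (ger0_norm (_ : 0 <= ln n)) ?(le_trans lm0).
rewrite (powR_div_expR s m0 n0) -{2}[m `^ s]mulr1 -mulrBr mulrA normrM.
have nd : `|ln n - ln m| = ln n - ln m by rewrite ger0_norm// subr_ge0.
have s0 := normr_ge0 s.
have ms2 : m `^ s <= 2.
  have : `|s * ln m| <= 2^-1 by rewrite normrM (ger0_norm lm0); nra.
  move=> h1; have := norm_expR_sub1 h1; rewrite powRE//.
  by move=> /(le_trans (ler_norm _)); lra.
have es : `|expR (s * (ln n - ln m)) - 1| <= 2 * `|s * (ln n - ln m)|.
  by apply: norm_expR_sub1; rewrite normrM nd; nra.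
rewrite normrM nd in es.
have -> : 2 * `|s| * (2 * a * m `^ t * (ln n - ln m)) =
  (a * m `^ t * 2) * (2 * (`|s| * (ln n - ln m))) by ring.
apply: ler_pM => //.
rewrite ger0_norm ?mulr_ge0 ?powR_ge0 ?(ltW a0)//.
by rewrite ler_wpM2l// mulr_ge0// ltW.
Qed.

(** Intermediate value theorem between t - d and t + d. With E = (n / m)^d >= 1 + d ln (n / m), the
    growth term a m^t (E - 1) dominates 2|h(t)| + 2|b|; the factors 2 absorb n^d, which lies in
    [1, 2] because d ln n <= 1/2. *)
Lemma powR_form_root a m n t d b : 0 < a -> 1 <= m -> m <= n -> 0 <= d ->
  d * ln n <= 2^-1 ->
  2 * `|powR_form a m n t| + 2 * `|b| <= a * m `^ t * d * (ln n - ln m) ->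
  exists2 t1, t - d <= t1 <= t + d & powR_form a m n t1 = b.
Proof.
move=> a0 m1 mn d0 dn H.
have m0 : 0 < m by lra.
have n0 : 0 < n by lra.
have lm0 : 0 <= ln m by rewrite ln_ge0.
have lmn : ln m <= ln n by rewrite ler_ln// posrE.
have mt0 := powR_gt0 t m0.
have cf : continuous (powR_form a m n).
  move=> x; have E : powR_form a m n = (fun t => expR (t * ln n) - a * expR (t * ln m)).
    by apply/funext => y; rewrite /powR_form !powRE.
  rewrite E; apply: cvgB; last apply: cvgM; first last.
  - apply: continuous_comp; last exact: continuous_expR.
    by apply: cvgM; [exact: cvg_id|exact: cvg_cst].
  - exact: cvg_cst.
  - apply: continuous_comp; last exact: continuous_expR.
    by apply: cvgM; [exact: cvg_id|exact: cvg_cst].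
have hn := ler_norm (powR_form a m n t).
have hn' := ler_norm (- powR_form a m n t); rewrite normrN in hn'.
have bn := ler_norm b; have bn' := ler_norm (- b); rewrite normrN in bn'.
have h0 := normr_ge0 (powR_form a m n t); have b0 := normr_ge0 b.
set h := powR_form a m n t in H hn hn' h0 *.
have E1 := expR_ge1Dx (d * (ln n - ln m)).
set E := expR _ in E1.
have amE : 2 * `|h| + 2 * `|b| <= a * m `^ t * (E - 1).
  rewrite (le_trans H)// -mulrA ler_wpM2l ?mulr_ge0 ?(ltW a0) ?(ltW mt0)//.
  by rewrite lerBrDl.
have nd2 : 1 <= n `^ d <= 2.
  have dn0 : 0 <= d * ln n by rewrite mulr_ge0// (le_trans lm0).
  rewrite powRE//; apply/andP; split.
    by rewrite (le_trans _ (expR_ge1Dx _))// lerDl.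
  have := @norm_expR_sub1 _ (d * ln n); rewrite ger0_norm// => /(_ dn).
  by move=> /(le_trans (ler_norm _)); lra.
have md1 : 1 <= m `^ d by rewrite -(powRr0 m) ler_powR.
have ndE : n `^ d = m `^ d * E by exact: powR_div_expR.
have hi : b <= powR_form a m n (t + d).
  rewrite powR_formD// -/h {2}ndE.
  have : a * m `^ t * (E - 1) <= m `^ d * (a * m `^ t * (E - 1)).
    by rewrite ler_peMl// (le_trans _ amE)//; lra.
  have -> : a * m `^ t * (m `^ d * E - m `^ d) =
            m `^ d * (a * m `^ t * (E - 1)) by ring.
  by move: nd2 => /andP[? ?]; nra.
have lo : powR_form a m n (t - d) <= b.
  rewrite powR_formD// -/h !powRN ndE.
  have E0 : 0 < E by exact: expR_gt0.
  have md0 : 0 < m `^ d by lra.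
  have -> : h * (m `^ d * E)^-1 + a * m `^ t * ((m `^ d * E)^-1 - (m `^ d)^-1)
     = (m `^ d * E)^-1 * (h - a * m `^ t * (E - 1)).
    by field; rewrite ?gt_eqF.
  rewrite -ndE mulrC ler_pdivrMr; last by lra.
  by move: nd2 => /andP[? ?]; nra.
have [t1 t1d <-] : exists2 c, c \in `[t - d, t + d] & powR_form a m n c = b.
  apply: IVT; first by lra.
    by apply: continuous_subspaceT.
  by rewrite ge_min lo/= le_max hi orbT.
by exists t1 => //; move: t1d; rewrite in_itv.
Qed.
End LinearForm.

(** * Rational approximation *)

(** Pigeonhole: the D + 1 fractional parts of i x, for i from 0 to D, fall into D bins of length
    1/D. The numerator is positive because d x > 1 while |d x - e| < 1. *)
Lemma dirichlet_approx (R : realType) (x : R) (D : nat) : 1 < x -> (0 < D)%N ->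
  exists d e : nat, [/\ (0 < d <= D)%N, (0 < e)%N &
    `|x - e%:R / d%:R| <= (d%:R * D%:R)^-1].
Proof.
move=> x1 D0.
have D0' : 0 < D%:R :> R by rewrite ltr0n.
pose fr (i : nat) : R := i%:R * x - (Num.floor (i%:R * x))%:~R.
have fr01 i : 0 <= fr i < 1.
  have := floor_itv (i%:R * x); rewrite intrD => /andP[? ?].
  by rewrite /fr subr_ge0; apply/andP; split => //; lra.
have binP (i : 'I_D.+1) : (Num.truncn (D%:R * fr i) < D)%N.
  have /andP[f0 f1] := fr01 i.
  by rewrite truncn_lt_nat ?mulr_ge0// gtr_pMr.
have /injectivePn[i [j ij ijE]] :
    ~~ injectiveb (fun i : 'I_D.+1 => Ordinal (binP i)).
  apply/negP => /injectiveP /leq_card; rewrite !card_ord; lia.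
wlog ltij : i j ij ijE / (i < j)%N.
  move=> W; have := ij; rewrite -val_eqE/= neq_ltn => /orP[|] ?; first exact: (W i j).
  by apply: (W j i) => //; rewrite eq_sym.
have {}ijE : Num.truncn (D%:R * fr i) = Num.truncn (D%:R * fr j) by case: ijE.
have dfr : `|fr j - fr i| < D%:R^-1.
  have /andP[fi0 _] := fr01 i; have /andP[fj0 _] := fr01 j.
  have := truncn_itv (mulr_ge0 (ltW D0') fi0).
  have := truncn_itv (mulr_ge0 (ltW D0') fj0).
  rewrite -ijE => /andP[a1 a2] /andP[b1 b2].
  rewrite -(@ltr_pM2l _ D%:R)// divff ?gt_eqF//.
  rewrite -[X in X * _](gtr0_norm D0') -normrM mulrBr ltr_norml.
  by move: a2 b2; rewrite -natr1; lra.
pose d := (j - i)%N.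
pose e := Num.floor (j%:R * x) - Num.floor (i%:R * x).
have d0 : (0 < d)%N by rewrite subn_gt0.
have d1 : 1 <= d%:R :> R by rewrite ler1n.
have frE : fr j - fr i = d%:R * x - e%:~R.
  by rewrite /fr /d /e natrB ?(ltnW ltij)// rmorphB/=; ring.
have Dinv : D%:R^-1 <= 1 :> R by rewrite invf_le1// ler1n.
have e0 : 0 < e.
  rewrite -(ltr_int R); move: dfr; rewrite frE ltr_norml => /andP[_].
  by nra.
have eE : e = `|e|%N :> int by rewrite gez0_abs// ltW.
exists d, `|e|%N; split.
- by rewrite d0 /d (leq_trans (leq_subr _ _))// -ltnS.
- by rewrite absz_gt0 gt_eqF.
- have -> : x - `|e|%N%:R / d%:R = d%:R^-1 * (d%:R * x - e%:~R).
    rewrite {2}eE -pmulrn; field; lra.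
  rewrite normrM ger0_norm ?invr_ge0// invfM ler_wpM2l// ?invr_ge0//.
  by rewrite -frE ltW.
Qed.

(* A Dirichlet fraction [e / d] with [d <= D] is expanded by the largest [k] with
   [(k d)^t <= d D]; such a [k > 0] exists because [t <= 2]. *)
Lemma approx_powR (R : realType) (x t : R) (N : nat) : 1 < x -> 1 <= t <= 2 ->
  exists m n : nat, [/\ (N <= m)%N, (0 < m)%N, (0 < n)%N &
    `|x - n%:R / m%:R| <= (m%:R `^ t)^-1].
Proof.
(* The square root of [D] is 2(N + 1), so y = (d D)^(1/t) >= 2(N + 1) as t <= 2. Since k >= 1, the
   denominator k d exceeds y / 2, hence [N]. *)
move=> x1 /andP[t1 t2]; pose D := ((2 * N.+1) ^ 2)%N.
have D0 : (0 < D)%N by rewrite expn_gt0.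
have [d [e [/andP[d0 dD] e0 de]]] := dirichlet_approx x1 D0.
have d1 : 1 <= d%:R :> R by rewrite ler1n.
have D1 : 1 <= D%:R :> R by rewrite ler1n.
pose y : R := (d%:R * D%:R) `^ t^-1.
have t0 : 0 < t by lra.
have ti0 : 0 <= t^-1 by rewrite invr_ge0 ltW.
have dD1 : 1 <= d%:R * D%:R :> R by nra.
have dy : d%:R <= y.
  have -> : d%:R = (d%:R `^ t) `^ t^-1 :> R.
    by rewrite -powRrM divff ?gt_eqF// powRr1.
  apply: ge0_ler_powR; rewrite ?nnegrE ?powR_ge0 ?mulr_ge0//.
  rewrite (@le_trans _ _ (d%:R `^ 2))// ?ler_powR//.
  by rewrite powR_mulrn ?expr2 ?ler_wpM2l ?ler_nat.
have Ny : 2 * N.+1%:R <= y.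
  have -> : 2 * N.+1%:R = (D%:R : R) `^ 2^-1.
    by rewrite powR12_sqrt// /D natrX sqrtr_sqr natrM ger0_norm.
  rewrite (@le_trans _ _ (D%:R `^ t^-1))//.
    by rewrite ler_powR// lef_pV2 ?posrE.
  apply: ge0_ler_powR; rewrite ?nnegrE//; nra.
clear dD; clearbody D.
have dR0 : 0 < d%:R :> R by lra.
pose k := Num.truncn (y / d%:R).
have yd1 : 1 <= y / d%:R by rewrite ler_pdivlMr// mul1r.
have k0 : (0 < k)%N by rewrite /k truncn_gt0.
have := truncn_itv (le_trans ler01 yd1); rewrite -/k => /andP[k1 k2].
rewrite ler_pdivlMr// in k1; rewrite ltr_pdivrMr// in k2.
have kR : 1 <= k%:R :> R by rewrite ler1n.
have kd : 0 < k%:R * d%:R :> R by nra.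
exists (k * d)%N, (k * e)%N; split.
- by rewrite -(ler_nat R) natrM; move: k2 Ny; rewrite -!natr1; nra.
- by rewrite muln_gt0 k0.
- by rewrite muln_gt0 k0.
- have -> : (k * e)%:R / (k * d)%:R = e%:R / d%:R :> R.
    have kR0 : 0 < k%:R :> R by exact: lt_le_trans kR.
    by rewrite !natrM; field; rewrite !gt_eqF.
  rewrite (le_trans de)// lef_pV2 ?posrE ?powR_gt0 ?natrM ?(lt_le_trans ltr01 dD1)//.
  have -> : d%:R * D%:R = y `^ t.
    by rewrite /y -powRrM mulVf ?gt_eqF// powRr1// (le_trans ler01).
  by apply: ge0_ler_powR; rewrite ?nnegrE ?powR_ge0 ?mulr_ge0// ltW.
Qed.

(** * Exponents below 2, first step: n^t - a m^t close to b + 1/4 *)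

Lemma ler_ln_sqrt (R : realType) (x : R) : 0 < x -> ln x <= 2 * Num.sqrt x.
Proof.
move=> x0; rewrite -[X in ln X](sqr_sqrtr (ltW x0)) lnXn ?sqrtr_gt0//.
by rewrite -[leLHS]mulr_natl ler_wpM2l// ltW// ln_sublinear// sqrtr_gt0.
Qed.

(** For y <= x, the difference y^t ((x/y)^t - 1) grows with t, so it is at most its value (x + y)(x
    - y) at t = 2. *)
Lemma ler_dist_powR (R : realType) (x y P t : R) :
  1 <= x <= P -> 1 <= y <= P -> 1 <= t <= 2 ->
  `|x `^ t - y `^ t| <= 2 * P * `|x - y|.
Proof.
wlog yx : x y / y <= x.
  move=> W hx hy ht; have /orP[|] := le_total y x; first by move=> ?; exact: W.
  by move=> ?; rewrite distrC [in leRHS]distrC; exact: W.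
move=> /andP[x1 xP] /andP[y1 yP] /andP[t1 t2].
have y0 : 0 < y by lra.
have yt0 : 0 < y `^ t by exact: powR_gt0.
have yt : y `^ t <= y ^+ 2 by rewrite -powR_mulrn ?ler_powR// ltW.
have xy1 : 1 <= x / y by rewrite ler_pdivlMr// mul1r.
have E : x `^ t = (x / y) `^ t * y `^ t.
  by rewrite -powRM ?divfK ?gt_eqF// ltW// (lt_le_trans ltr01).
have le2 : (x / y) `^ t <= (x / y) ^+ 2.
  by rewrite -powR_mulrn ?ler_powR// (le_trans ler01).
have ge1 : y `^ t <= x `^ t by apply: ge0_ler_powR; rewrite ?nnegrE; lra.
rewrite !ger0_norm ?subr_ge0//.
have -> : x `^ t - y `^ t = y `^ t * ((x / y) `^ t - 1) by rewrite E; ring.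
apply: (@le_trans _ _ (y ^+ 2 * ((x / y) ^+ 2 - 1))).
  rewrite ler_pM ?(ltW yt0) ?subr_ge0 ?lerB//.
  by rewrite -(powRr0 (x / y)) ler_powR//; lra.
have -> : y ^+ 2 * ((x / y) ^+ 2 - 1) = (x + y) * (x - y) by field; lra.
by apply: ler_wpM2r; lra.
Qed.

Lemma powR_form_ratio (R : realType) (a m n t : R) : 0 < m -> 0 < n ->
  powR_form a m n t = m `^ t * ((n / m) `^ t - a).
Proof.
move=> m0 n0; rewrite /powR_form mulrBr -powRM ?divr_ge0 ?ltW//.
by congr (_ - _); [congr (_ `^ _); field; lra|ring].
Qed.

Lemma near_natR (R : realType) (x : R) : exists N : nat, forall n : nat,
  (N <= n)%N -> x <= n%:R.
Proof.
exists (Num.truncn x).+1 => n; rewrite -(ler_nat R) => /(le_trans _); apply.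
by rewrite ltW// truncnS_gt.
Qed.

(** The window is centred at b + 1/4 and leaves a margin of 1/8 on each side inside [b, b + 1/2],
    which is spent when the exponent is moved again to reach a residue class. *)
Definition near_line (R : realType) (a b : R) (N : nat) : set R :=
  [set t | exists m n : nat, [/\ (N <= m)%N, (0 < m)%N, (0 < n)%N &
     b + 8^-1 <= powR_form a m%:R n%:R t <= b + 3 / 8]].

(** After factoring out M^t, what remains is (M'/M)^t - x^t; the Lipschitz bound turns the
    approximation error M^-t into a constant. *)
Lemma approx_powR_form (R : realType) (x t M M' : R) : 1 <= x -> 1 <= t <= 2 ->
  0 < M -> 0 < M' -> 1 <= M' / M <= x + 1 -> `|x - M' / M| <= (M `^ t)^-1 ->
  `|powR_form (x `^ t) M M' t| <= 2 * (x + 1).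
Proof.
move=> x1 t12 M0 M'0 ro1 xro.
have mt0 := powR_gt0 t M0.
rewrite powR_form_ratio// normrM gtr0_norm// -[leRHS]mulr1.
have x1P : 1 <= x <= x + 1 by rewrite x1 lerDl ler01.
have dd := ler_wpM2l (ltW mt0) (ler_dist_powR ro1 x1P t12).
apply: (le_trans dd); rewrite mulrCA ler_wpM2l//; first by lra.
by rewrite -(divff (lt0r_neq0 mt0)) ler_wpM2l ?(ltW mt0)// distrC.
Qed.

(** Logarithms are O(sqrt M). This supplies the condition that the displacement C / M^t times ln M'
    is at most 1/2. *)
Lemma mul_ln_le_half (R : realType) (M M' C p : R) : 1 <= M -> 0 < C -> 0 <= p ->
  ln M' <= ln M + p -> (2 * C * (p + 2)) ^+ 2 <= M -> C * ln M' <= 2^-1 * M.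
Proof.
move=> M1 C0 p0 lM' CM.
have M0 : 0 < M by lra.
have sM := ler_ln_sqrt M0.
have sM1 : 1 <= Num.sqrt M by rewrite -[leLHS]sqrtr1 ler_sqrt// ltW.
have sM2 : 2 * C * (p + 2) <= Num.sqrt M.
  have q0 : 0 <= 2 * C * (p + 2).
    by apply: mulr_ge0; [apply: mulr_ge0 => //; exact: ltW|apply: addr_ge0].
  by rewrite -(ger0_norm q0) -sqrtr_sqr ler_sqrt// ltW.
rewrite -[X in _ <= _ * X](sqr_sqrtr (ltW M0)) expr2.
move: (Num.sqrt M) sM sM1 sM2 => r sM r1 r2.
have pr : p <= p * r by rewrite ler_peMr.
apply: (@le_trans _ _ (C * ((p + 2) * r))).
  by rewrite ler_pM2l// mulrDl; clear - lM' sM pr; lra.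
rewrite !mulrA ler_wpM2r//; first by clear - r1; lra.
by clear - r2; lra.
Qed.

(** [K] bounds h at [t]; [l] and [p] bound ln (M'/M) from below and above. The equation for [C] is
    the size condition of [powR_form_root] for the displacement C / M^t. Then [w] is small enough
    for [norm_powR_formB], started at the root [t1], to give a change of at most 1/8. *)
Lemma powR_form_hits (R : realType) (a M M' t b K l p C w : R) :
  0 < a -> 1 <= M -> M <= M' -> 0 < l -> l <= ln M' - ln M -> ln M' - ln M <= p ->
  0 < C -> C * (a * l) = 2 * K + 2 * `|b| ->
  w <= C -> 0 < w -> w * (2 * (`|b| / (2 * C) + 4 * a * p)) <= 8^-1 ->
  C / M `^ t * ln M' <= 2^-1 -> `|powR_form a M M' t| <= K ->
  exists2 t1, t - C / M `^ t <= t1 <= t + C / M `^ t &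
    forall s, `|s - t1| <= w / M `^ t -> `|powR_form a M M' s - b| <= 8^-1.
Proof.
move=> a0 M1 MM' l0 ll lp C0 CE wC w0 wL Cln hK.
have M0 : 0 < M by lra.
have M'0 : 0 < M' by lra.
have mt0 := powR_gt0 t M0.
have lM'0 : 0 <= ln M' by apply: ln_ge0; lra.
have lM0 : 0 <= ln M by exact: ln_ge0.
set T := M `^ t in mt0 Cln *.
set d := C / T in Cln *.
have d0 : 0 < d by rewrite divr_gt0.
have [t1 t1d ht1] : exists2 t1, t - d <= t1 <= t + d & powR_form a M M' t1 = b.
  apply: powR_form_root => //; first exact: ltW.
  have -> : a * T * d * (ln M' - ln M) = C * (a * (ln M' - ln M)).
    by rewrite /d; field; rewrite gt_eqF.
  have : C * (a * l) <= C * (a * (ln M' - ln M)) by rewrite !ler_pM2l.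
  by clear - hK CE; lra.
exists t1 => // s st1.
have wd : w / T <= d by rewrite ler_pM2r// invr_gt0.
have := @norm_powR_formB _ a M M' t1 (s - t1) a0 M1 MM'.
rewrite (addrC t1) subrK ht1 => Lip.
have sln : `|s - t1| * ln M' <= 2^-1.
  by rewrite (le_trans _ Cln)// ler_wpM2r// (le_trans st1).
apply: (le_trans (Lip sln)).
have m2t : M `^ t1 <= 2 * T.
  apply: (@le_trans _ _ (M `^ (t + d))).
    by rewrite ler_powR//; move: t1d => /andP[].
  rewrite powRD; last by apply/implyP; rewrite (gt_eqF M0).
  rewrite mulrC ler_wpM2r ?(ltW mt0)// powRE//.
  have dM0 : 0 <= d * ln M by rewrite mulr_ge0// ltW.
  have dM : d * ln M <= 2^-1.
    by rewrite (le_trans _ Cln)// ler_pM2l// ler_ln.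
  have := @norm_expR_sub1 _ (d * ln M).
  rewrite (ger0_norm dM0) => /(_ dM).
  by move=> /(le_trans (ler_norm _)); clear - dM; lra.
(* The logarithm is absorbed by M^t; this is the source of |b| / (2C) in the condition on [w]. *)
have lnt : ln M' / T <= (2 * C)^-1.
  have -> : ln M' / T = (d * ln M') / C.
    by rewrite /d; field; rewrite !gt_eqF.
  by rewrite invfM ler_pM2r ?invr_gt0.
have lr0 : 0 <= ln M' - ln M by rewrite (le_trans (ltW l0)).
apply: (@le_trans _ _ (2 * (w / T) * (`|b| * ln M' + 2 * a * (2 * T) * p))).
  have n1 : 0 <= 2 * `|s - t1| by rewrite mulr_ge0.
  have aT : 0 <= 2 * a * M `^ t1 by rewrite !mulr_ge0 ?powR_ge0// ltW.
  have n2 : 0 <= `|b| * ln M' + 2 * a * M `^ t1 * (ln M' - ln M).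
    by apply: addr_ge0; apply: mulr_ge0.
  apply: ler_pM => //; first by rewrite ler_pM2l.
  rewrite lerD2l; apply: ler_pM => //.
  by rewrite ler_wpM2l// mulr_ge0// ltW.
have -> : 2 * (w / T) * (`|b| * ln M' + 2 * a * (2 * T) * p) =
    w * (2 * (`|b| * (ln M' / T) + 4 * a * p)).
  by field; rewrite gt_eqF.
rewrite (le_trans _ wL)// ler_pM2l// ler_wpM2l// lerD2r.
by rewrite ler_wpM2l.
Qed.

Lemma near_line_porous (R : realType) (a b : R) (N : nat) (t : R) :
  1 < a -> 1 < t < 2 ->
  exists2 c : R, 0 < c & forall d : R, 0 < d ->
     exists u v r : R, [/\ 0 < r < d, t - r <= u, v <= t + r, c * r <= v - u &
       `]u, v[ `<=` near_line a b N].
Proof.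
move=> a1 /andP[t1 t2].
have a0 : 0 < a by lra.
have t0 : 0 < t by lra.
have t12 : 1 <= t <= 2 by rewrite (ltW t1) (ltW t2).
have [x xE] : exists x, x = a `^ t^-1 by eexists.
have xt : x `^ t = a by rewrite xE -powRrM mulVf ?gt_eqF// powRr1// ltW.
have x1 : 1 < x.
  by rewrite xE -(powRr0 a) /powR gt_eqF// ltr_expR ltr_pM2r ?ln_gt0 ?invr_gt0.
have [l lE] : exists l, l = ln ((1 + x) / 2) by eexists.
have l0 : 0 < l by rewrite lE ln_gt0//; lra.
have [p pE] : exists p, p = ln (x + 1) by eexists.
have p0 : 0 < p by rewrite pE ln_gt0//; lra.
have b0 := normr_ge0 (b + 4^-1).
have al0 : 0 < a * l by exact: mulr_gt0.
(* The target is b + 1/4, the centre of the window in [near_line]. [C] and [w] depend on a, b and t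
   only, not on the scale [d]. *)
have [C CE] : exists C, C * (a * l) = 2 * (2 * (x + 1)) + 2 * `|b + 4^-1|.
  by eexists; apply: divfK; rewrite gt_eqF.
have C0 : 0 < C by rewrite -(pmulr_lgt0 _ al0) CE; lra.
have [L LE] : exists L, L = 2 * (`|b + 4^-1| / (2 * C) + 4 * a * p) by eexists.
have L0 : 0 < L.
  have bC : 0 <= `|b + 4^-1| / (2 * C) by rewrite divr_ge0// ltW// mulr_gt0.
  have alP : 0 < 4 * a * p by rewrite mulr_gt0// mulr_gt0.
  by lra.
have [w [w0 wC wL]] : exists w, [/\ 0 < w, w <= C & w * L <= 8^-1].
  exists (Num.min C (8 * L)^-1); split.
  - by rewrite lt_min C0 invr_gt0 mulr_gt0.
  - by rewrite ge_min lexx.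
  - by rewrite -ler_pdivlMr// -invfM ge_min lexx orbT.
rewrite LE in wL; clear L LE L0 xE.
(* The hole will have length w / m^t and the radius will be r = 2C / m^t. *)
exists (w / (2 * C)); first by rewrite divr_gt0// mulr_gt0.
move=> d d0.
(* [N1] brings M'/M within (x - 1)/2 of x, hence above (1 + x)/2; [N2] makes C / M^t times ln M' at
   most 1/2; [N3] makes the radius smaller than [d]. *)
have [N1 N1P] := near_natR (2 / (x - 1)).
have [N2 N2P] := near_natR ((2 * C * (p + 2)) ^+ 2).
have [N3 N3P] := near_natR (2 * C / d + 1).
have [m [n [Nm m0 n0 xmn]]] := approx_powR (N + N1 + N2 + N3)%N x1 t12.
have Mn : (N <= m)%N by clear - Nm; lia.
move: {N1P}(N1P m (ltac:(clear - Nm; lia))) => m1.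
move: {N2P}(N2P m (ltac:(clear - Nm; lia))) => m2.
move: {N3P}(N3P m (ltac:(clear - Nm; lia))) => m3.
clear Nm N1 N2 N3.
have mge1 : 1 <= m%:R :> R by rewrite ler1n.
have np : 0 < n%:R :> R by rewrite ltr0n.
have [M mE] : exists M, M = m%:R :> R by eexists.
have [M' nE] : exists M', M' = n%:R :> R by eexists.
rewrite -?mE -?nE in xmn m1 m2 m3 mge1 np.
have mp : 0 < M by clear - mge1; lra.
have mt : M <= M `^ t by rewrite le1r_powR// ltW.
have mt0 : 0 < M `^ t by exact: powR_gt0.
have mti : (M `^ t)^-1 <= M^-1 by rewrite lef_pV2 ?posrE.
have mi1 : M^-1 <= 1 by rewrite invf_le1.
have mi2 : M^-1 <= (x - 1) / 2.
  by rewrite -[leRHS]invrK lef_pV2 ?posrE ?invr_gt0 ?divr_gt0 ?subr_gt0// invf_div.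
have [rol roP] : (1 + x) / 2 <= M' / M /\ M' / M <= x + 1.
  move: (xmn); rewrite ler_norml => /andP[]; clear - mti mi1 mi2.
  by move: (M' / M) => r ? ?; split; lra.
have ro1 : 1 <= M' / M by clear - rol x1; lra.
have ro0 : 0 < M' / M by rewrite divr_gt0.
have MM' : M <= M' by rewrite -(mul1r M) -ler_pdivlMr.
have lro : ln M' - ln M = ln (M' / M) by rewrite ln_div ?posrE.
have llro : l <= ln M' - ln M.
  by rewrite lro lE ler_ln ?posrE//; clear - x1; lra.
have rop : ln M' - ln M <= p.
  by rewrite lro pE ler_ln ?posrE//; clear - x1; lra.
have hK : `|powR_form a M M' t| <= 2 * (x + 1).
  by rewrite -xt approx_powR_form ?ro1 ?(ltW x1).
have Cln : C / M `^ t * ln M' <= 2^-1.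
  rewrite mulrAC ler_pdivrMr// (le_trans _ (ler_wpM2l _ mt))//.
  apply: (mul_ln_le_half mge1 C0 (ltW p0)) => //.
  by clear - rop; lra.
have [s0 /andP[s01 s02] hs] :=
  powR_form_hits a0 mge1 MM' l0 llro rop C0 CE wC w0 wL Cln hK.
have wd : w / M `^ t <= C / M `^ t by rewrite ler_pM2r// invr_gt0.
have Ct0 : 0 < C / M `^ t by rewrite divr_gt0.
exists s0, (s0 + w / M `^ t), (2 * (C / M `^ t)); split.
- rewrite mulr_gt0//= mulrA ltr_pdivrMr//.
  rewrite (lt_le_trans _ (ler_wpM2l _ mt)) ?(ltW d0)//.
  by rewrite [ltRHS]mulrC -ltr_pdivrMr// (lt_le_trans _ m3)// ltrDl.
- by clear - s01 Ct0; lra.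
- by clear - s02 wd; lra.
- rewrite [leRHS]addrC addKr le_eqVlt; apply/orP; left; apply/eqP.
  by field; rewrite !gt_eqF.
- move=> s /=; rewrite in_itv/= => /andP[s1 s2].
  exists m, n; split => //; rewrite -mE -nE.
  have ss : `|s - s0| <= w / M `^ t by clear - s1 s2; rewrite ger0_norm; lra.
  move: (hs s ss); clear.
  by rewrite ler_norml => /andP[? ?]; apply/andP; split; lra.
Qed.

(** * Exponents below 2, second step: prescribing the residue class of the floor *)

(* Since [a * (4 * a)^-1 + 1/2 < 1], these inequalities force [floor (m^t) = x] and,
   when [a x + b] is an integer, [floor (n^t) = a x + b]. *)
Definition floor_line (R : realType) (a b : R) (q x0 : int) (N : nat) : set R :=
  [set t | exists m n : nat, exists x : int,
    [/\ (N <= m)%N, (0 < m)%N, (0 < n)%N, (q %| x - x0)%Z &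
     x%:~R <= m%:R `^ t <= x%:~R + (4 * a)^-1 /\
     b <= powR_form a m%:R n%:R t <= b + 2^-1]].

Lemma int_residue_gt (R : realType) (y : R) (q x0 : int) : 0 < q ->
  exists x : int, (q %| x - x0)%Z /\ y < x%:~R <= y + q%:~R.
Proof.
move=> q0; have q0' : 0 < q%:~R :> R by rewrite ltr0z.
pose k := Num.floor ((y - x0%:~R) / q%:~R).
have := floor_itv ((y - x0%:~R) / q%:~R); rewrite -/k intrD => /andP[k1 k2].
rewrite ler_pdivlMr// in k1; rewrite ltr_pdivrMr// in k2.
exists (x0 + (k + 1) * q); split; first by rewrite addrC addKr dvdz_mull.
by rewrite !rmorphD/= rmorphM/= rmorphD/=; apply/andP; split; lra.
Qed.

(* [u, v] is the interval on which [M^s] runs from [X] to [X + eps]. *)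
Lemma powR_window (R : realType) (M t X eps Q : R) : 1 < M -> 0 <= t ->
  M `^ t < X -> X + 1 <= M `^ t + Q -> 0 < eps <= 1 ->
  exists u v : R, [/\ t <= u, v <= t + Q / (M `^ t * ln M),
     eps / (Q * (Q + 1)) * (Q / (M `^ t * ln M)) <= v - u &
     forall s, u <= s <= v -> X <= M `^ s <= X + eps].
Proof.
move=> M1 t0 xM xQ /andP[e0 e1].
have mp : 0 < M by lra.
have mt1 : 1 <= M `^ t by rewrite -(powRr0 M) ler_powR// ltW.
have lM0 : 0 < ln M by exact: ln_gt0.
have tE : t = ln (M `^ t) / ln M by rewrite ln_powR mulfK ?gt_eqF.
have MsE s : M `^ s = expR (s * ln M) by exact: powRE.
move: (ln M) lM0 tE MsE => L L0 tE MsE.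
move: (M `^ t) mt1 xM xQ tE => T T1 xM xQ tE.
have T0 : 0 < T by lra.
have X0 : 0 < X by lra.
have Q1 : 1 <= Q by lra.
exists (ln X / L), (ln (X + eps) / L); split.
- by rewrite {1}tE ler_pM2r ?invr_gt0// ler_ln ?posrE// ltW.
- have -> : t + Q / (T * L) = (ln T + Q / T) / L.
    by rewrite {1}tE; field; rewrite !gt_eqF.
  rewrite ler_pM2r ?invr_gt0// -lerBlDl -ln_div ?posrE//; last by lra.
  have -> : (X + eps) / T = 1 + (X + eps - T) / T by field; rewrite gt_eqF.
  apply: (le_trans (le_ln1Dx _)).
    by rewrite (lt_le_trans (_ : _ < 0)) ?oppr_lt0// divr_ge0; lra.
  by rewrite ler_pM2r ?invr_gt0//; lra.
- have Xe0 : 0 < X + eps by lra.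
  have Xe1 : eps / (X + eps) < 1 by rewrite ltr_pdivrMr//; lra.
  have -> : ln (X + eps) / L - ln X / L = - ln (1 - eps / (X + eps)) / L.
    rewrite -mulrBl -ln_div ?posrE// -lnV ?posrE ?subr_gt0//.
    by congr (ln _ / _); field; rewrite !gt_eqF// addrK.
  (* This bounds ln ((X + eps) / X) below by eps / (X + eps). The factor Q + 1 comes from X + eps <=
     T + Q <= (Q + 1) T, with T = M^t >= 1. *)
  have l1 : eps / (X + eps) <= - ln (1 - eps / (X + eps)).
    by rewrite lerNr le_ln1Dx// ltrN2.
  apply: (@le_trans _ _ (eps / (X + eps) / L)); last first.
    by rewrite ler_pM2r// invr_gt0.
  have Q0 : 0 < Q by lra.
  have Q10 : 0 < Q + 1 by lra.
  have -> : eps / (Q * (Q + 1)) * (Q / (T * L)) = eps / ((Q + 1) * T) / L.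
    by field; rewrite !gt_eqF.
  have QT : Q <= Q * T by rewrite ler_peMr// ltW.
  have XQT : X + eps <= (Q + 1) * T by rewrite mulrDl; lra.
  by rewrite ler_pM2r ?invr_gt0// ler_pM2l// lef_pV2 ?posrE// mulr_gt0.
- move=> s /andP[s1 s2].
  have Xe0 : 0 < X + eps by lra.
  rewrite MsE -{1}(lnK (_ : X \is Num.pos))// -(lnK (_ : X + eps \is Num.pos))//.
  by rewrite !ler_expR -ler_pdivrMr// s1 -ler_pdivlMr.
Qed.

(** Membership in [near_line] says nothing about n / m, so its bounds are recovered here. If M' < M
    then h <= -(a - 1) M < -K, which is excluded; afterwards M'/M <= (M'/M)^t = a + h / M^t. *)
Lemma powR_form_ratio_bound (R : realType) (a M M' t K : R) :
  1 < a -> 1 <= t -> 1 <= M -> 0 < M' -> 0 <= K -> K < (a - 1) * M ->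
  `|powR_form a M M' t| <= K -> M <= M' /\ M' / M <= a + K.
Proof.
move=> a1 t1 M1 M'0 K0 KM; rewrite ler_norml => /andP[h1 h2].
have mp : 0 < M by lra.
have mt : M <= M `^ t by rewrite le1r_powR.
have hE : M' `^ t = a * M `^ t + powR_form a M M' t by rewrite /powR_form; ring.
move: (powR_form a M M' t) h1 h2 hE => h h1 h2 hE.
have MM' : M <= M'.
  rewrite leNgt; apply/negP => lt.
  have lt' : M' `^ t <= M `^ t by apply: ge0_ler_powR; rewrite ?nnegrE; lra.
  have : (a - 1) * M <= (a - 1) * M `^ t by rewrite ler_wpM2l//; lra.
  by move: lt'; rewrite hE; lra.
split => //.
have ro1 : 1 <= M' / M by rewrite ler_pdivlMr// mul1r.
apply: (@le_trans _ _ ((M' / M) `^ t)); first by rewrite le1r_powR.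
have -> : (M' / M) `^ t = M' `^ t / M `^ t.
  rewrite powRM ?invr_ge0 ?(ltW mp) ?(ltW M'0)// -powR_inv1 ?(ltW mp)//.
  by rewrite powRAC powR_inv1// powR_ge0.
have mt0 : 0 < M `^ t by lra.
have mt1 : 1 <= M `^ t by lra.
have KMt : K <= K * M `^ t by rewrite ler_peMr.
by rewrite ler_pdivrMr// hE mulrDl lerD2l (le_trans h2).
Qed.

(** For a displacement Q / (M^t ln M) the two terms of [norm_powR_formB] are O(1/M) and O(1/ln M).
    The constants 64 make each of them at most 4/64, for a total of 1/8. *)
Lemma powR_form_near (R : realType) (a M M' t s K l Q : R) :
  0 < a -> 1 <= t -> 1 <= M -> M <= M' -> 1 <= ln M -> l <= ln M ->
  ln M' - ln M <= l -> 1 <= K -> 0 < Q ->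
  64 * Q * K <= M -> 64 * Q * a * l <= ln M ->
  `|powR_form a M M' t| <= K -> `|s - t| <= Q / (M `^ t * ln M) ->
  `|powR_form a M M' s - powR_form a M M' t| <= 8^-1.
Proof.
move=> a0 t1 M1 MM' lM1 lM lMM' K1 Q0 QK Ql hK st.
have mp : 0 < M by lra.
have mt : M <= M `^ t by rewrite le1r_powR.
have := @norm_powR_formB _ a M M' t (s - t) a0 M1 MM'.
rewrite (addrC t) subrK.
have lro0 : 0 <= ln M' - ln M by rewrite subr_ge0 ler_ln// posrE; lra.
move: (powR_form a M M' t) (powR_form a M M' s) hK => h h' hK.
move: (ln M') (ln M) (M `^ t) mt st lM1 lM lMM' lro0 Ql => L' L T mt st L1 lL lLL lro0 Ql.
have T0 : 0 < T by lra.
have L0 : 0 < L by lra.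
have L'0 : 0 <= L' by lra.
pose r := Q / (T * L).
have r0 : 0 < r by rewrite divr_gt0// mulr_gt0.
have rM : r * L = Q / T by rewrite /r; field; rewrite !gt_eqF.
have QM : Q / T <= Q / M by rewrite ler_pM2l// lef_pV2 ?posrE.
have QMK : Q / M * K <= 64^-1.
  by rewrite mulrAC ler_pdivrMr//; lra.
have QM64 : Q / M <= 64^-1.
  by rewrite (le_trans _ QMK)// ler_peMr// divr_ge0// ltW.
have rL' : r * L' <= 2 * (Q / M).
  apply: (@le_trans _ _ (r * (2 * L))); first by rewrite ler_pM2l//; lra.
  by rewrite mulrCA rM; lra.
have sL' : `|s - t| * L' <= 2^-1.
  apply: (@le_trans _ _ (r * L')); first by rewrite ler_wpM2r.
  by lra.
move=> /(_ sL') /le_trans; apply.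
have h1 : K * (r * L') <= 2 * (Q / M * K).
  by rewrite [in leRHS](mulrC _ K) (mulrCA 2 K) ler_wpM2l//; lra.
have h2 : Q * a * l / L <= 64^-1 by rewrite ler_pdivrMr//; lra.
apply: (@le_trans _ _ (2 * r * (K * L' + 2 * a * T * l))).
  have n1 : 0 <= 2 * `|s - t| by rewrite mulr_ge0.
  have aT : 0 <= 2 * a * T by rewrite !mulr_ge0// ltW.
  have n2 : 0 <= `|h| * L' + 2 * a * T * (L' - L).
    by apply: addr_ge0; apply: mulr_ge0.
  apply: ler_pM => //; first by rewrite ler_pM2l.
  by apply: lerD; [exact: ler_wpM2r|exact: ler_wpM2l].
have -> : 2 * r * (K * L' + 2 * a * T * l) =
    2 * (K * (r * L')) + 4 * (Q * a * l / L).
  by rewrite /r; field; rewrite !gt_eqF.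
by clear - h1 h2 QMK; lra.
Qed.

(** A pair (m, n) given by [near_line] is kept while the exponent grows by at most Q / (m^t ln m).
    In that range m^t passes the next integer of the residue class, and h drifts by at most 1/8, so
    it stays in [b, b + 1/2]. *)
Lemma floor_line_porous (R : realType) (a b : R) (q x0 : int) (N : nat) (t : R) :
  1 < a -> 0 < q -> 1 < t < 2 -> (forall N', near_line a b N' t) ->
  exists2 c : R, 0 < c & forall d : R, 0 < d ->
     exists u v r : R, [/\ 0 < r < d, t - r <= u, v <= t + r, c * r <= v - u &
       `]u, v[ `<=` floor_line a b q x0 N].
Proof.
move=> a1 q0 /andP[t1 t2] nl.
have a0 : 0 < a by lra.
have tge1 := ltW t1.
have b0 := normr_ge0 b.
have [K KE] : exists K, K = `|b| + 1 by eexists.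
have [P PE] : exists P, P = a + K by eexists.
(* The next integer of the class is at most q above m^t; the additional 1 leaves room for the window
   of width [eps] after it. *)
have [Q QE] : exists Q, Q = q%:~R + 1 :> R by eexists.
have [eps epsE] : exists eps, eps = (4 * a)^-1 by eexists.
have Q1 : 1 < Q by rewrite QE ltrDr ltr0z.
have e0 : 0 < eps by rewrite epsE invr_gt0; lra.
have e1 : eps <= 1 by rewrite epsE invf_le1; lra.
have K1 : 1 <= K by lra.
have P2 : 2 <= P by lra.
have lP0 : 0 < ln P by apply: ln_gt0; lra.
have Q0 : 0 < Q by lra.
have K0 : 0 < K by lra.
exists (eps / (Q * (Q + 1))); first by rewrite divr_gt0// mulr_gt0//; lra.
move=> d d0.
(* [N1] and [N5] give the two conditions with 64 in [powR_form_near]; [N2] gives K < (a - 1) M for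
   the ratio bound; [N3] gives ln P <= ln M; [N4] makes the radius smaller than [d]. *)
have [N1 N1P] := near_natR (64 * Q * K).
have [N2 N2P] := near_natR (K / (a - 1) + 1).
have [N3 N3P] := near_natR P.
have [N4 N4P] := near_natR (Q / d + 2).
have [N5 N5P] := near_natR (expR (64 * Q * a * ln P + 1)).
have [m [n [Nm m0 n0 mn]]] := nl (N + N1 + N2 + N3 + N4 + N5)%N.
have Mn : (N <= m)%N by clear - Nm; lia.
move: {N1P}(N1P m (ltac:(clear - Nm; lia))) => m1.
move: {N2P}(N2P m (ltac:(clear - Nm; lia))) => m2.
move: {N3P}(N3P m (ltac:(clear - Nm; lia))) => m3.
move: {N4P}(N4P m (ltac:(clear - Nm; lia))) => m4.
move: {N5P}(N5P m (ltac:(clear - Nm; lia))) => m5.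
clear Nm N1 N2 N3 N4 N5.
have mge1 : 1 <= m%:R :> R by rewrite ler1n.
have np : 0 < n%:R :> R by rewrite ltr0n.
have [M mE] : exists M, M = m%:R :> R by eexists.
have [M' nE] : exists M', M' = n%:R :> R by eexists.
rewrite -?mE -?nE in mn m1 m2 m3 m4 m5 mge1 np.
have mp : 0 < M by lra.
have {}m2 : K < (a - 1) * M.
  rewrite mulrC -ltr_pdivrMr; first by rewrite (lt_le_trans _ m2)// ltrDl.
  by rewrite subr_gt0.
have {}m5 : 64 * Q * a * ln P + 1 <= ln M by rewrite -ler_expR lnK.
have QaP : 0 < Q * a * ln P by rewrite mulr_gt0// mulr_gt0.
have {}m4 : Q < M * d.
  by rewrite -ltr_pdivrMr// (lt_le_trans _ m4)// ltrDl.
have lM1 : 1 <= ln M by clear - m5 QaP; lra.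
have lM0 : 0 < ln M by clear - lM1; lra.
have M1 : 1 < M by rewrite -ltr_ln ?posrE// ln1.
have m5' : 64 * Q * a * ln P <= ln M by clear - m5; lra.
have lM : ln P <= ln M by rewrite ler_ln ?posrE//; clear - P2; lra.
have mt : M <= M `^ t by rewrite le1r_powR.
have mt0 : 0 < M `^ t by exact: powR_gt0.
have hK : `|powR_form a M M' t| <= K.
  have := ler_norm b; have := ler_norm (- b); rewrite normrN KE.
  clear - mn; move: mn => /andP[? ?] ? ?; rewrite ler_norml.
  by apply/andP; split; lra.
have [MM' roP] := powR_form_ratio_bound a1 tge1 mge1 np (ltW K0) m2 hK.
have lro : ln M' - ln M <= ln P.
  rewrite -ln_div ?posrE// ler_ln ?posrE ?divr_gt0// ?PE//.
  by clear - a0 K0; lra.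
have [x [xx0 /andP[xM xQ]]] := @int_residue_gt R (M `^ t) q x0 q0.
have XQ1 : x%:~R + 1 <= M `^ t + Q by rewrite QE addrA lerD2r.
have [u [v [tu vt ruv uvX]]] := powR_window M1 (le_trans ler01 tge1) xM XQ1
  (introT andP (conj e0 e1)).
pose r := Q / (M `^ t * ln M).
have r0 : 0 < r by rewrite divr_gt0// mulr_gt0.
have ML : M <= M `^ t * ln M by rewrite (le_trans mt)// ler_peMr// ltW.
exists u, v, r; split => //.
- rewrite r0/= ltr_pdivrMr ?mulr_gt0// mulrC (lt_le_trans m4)//.
  by rewrite ler_pM2r.
- by rewrite (le_trans _ tu)// gerBl ltW.
- move=> s /=; rewrite in_itv/= => /andP[s1 s2].
  exists m, n, x; split => //; rewrite -mE -nE; split.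
    by rewrite -epsE; apply: uvX; rewrite (ltW s1) (ltW s2).
  have ss : `|s - t| <= Q / (M `^ t * ln M).
    by clear - s1 s2 tu vt; rewrite ger0_norm; lra.
  have := powR_form_near a0 tge1 mge1 MM' lM1 lM lro K1 Q0 m1 m5' hK ss.
  clear - mn; move: mn => /andP[? ?].
  by rewrite ler_norml => /andP[? ?]; apply/andP; split; lra.
Qed.

(** * Exponents above 2: Borel-Cantelli *)

(* Comparison with the telescoping series of [m^-d - (m+1)^-d]. *)
Lemma nneseries_powR_lty (R : realType) (d c : R) : 0 < d -> 0 <= c ->
  (\sum_(m <oo) (c * (m.+2%:R `^ (1 + d))^-1)%:E < +oo)%E.
Proof.
move=> d0 c0; apply: (@le_lt_trans _ _ (c / d)%:E); last exact: ltry.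
pose f (m : nat) : R := (m.+1%:R `^ d)^-1.
(* With x = m + 2, this is (x - 1)^-d >= x^-d (1 + d/x), from -ln (1 - 1/x) >= 1/x and e^y >= 1 +
   y. *)
have step m : c * (m.+2%:R `^ (1 + d))^-1 <= c / d * (f m - f m.+1).
  rewrite -mulrA ler_wpM2l// ler_pdivlMl//.
  set x : R := m.+2%:R; have x1 : m.+1%:R = x - 1 :> R by rewrite /x -(@natr1 _ m.+1) addrK.
  have x2 : 2 <= x by rewrite ler_nat.
  have x0 : 0 < x by lra.
  have x10 : 0 < x - 1 by lra.
  have xd0 := powR_gt0 d x0.
  rewrite /f -/x x1.
  have -> : ((x - 1) `^ d)^-1 = (x `^ d)^-1 * expR (d * (- ln (1 - x^-1))).
    rewrite -!powRN !powRE// -expRD; congr expR.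
    have -> : x - 1 = x * (1 - x^-1) by field; lra.
    rewrite lnM ?posrE//; first by ring.
    by rewrite subr_gt0 invf_lt1//; lra.
  have -> : x `^ (1 + d) = x * x `^ d.
    by rewrite powRD ?powRr1 ?(ltW x0)//; apply/implyP; rewrite (gt_eqF x0).
  have l1 : x^-1 <= - ln (1 - x^-1).
    by rewrite lerNr le_ln1Dx// ltrN2 invf_lt1//; lra.
  have := expR_ge1Dx (d * (- ln (1 - x^-1))) => e1.
  have e2 : d * x^-1 <= d * (- ln (1 - x^-1)) by rewrite ler_pM2l.
  set z := (x `^ d)^-1; set e := expR _ in e1 *.
  have -> : d * (x * x `^ d)^-1 = z * (d * x^-1) by rewrite invfM -/z; ring.
  have -> : z * e - z = z * (e - 1) by ring.
  have z0 : 0 <= z by rewrite invr_ge0 ltW.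
  by apply: ler_wpM2l => //; rewrite lerBrDl; apply: le_trans e1; rewrite lerD2l.
apply: lime_le.
  by apply: is_cvg_nneseries => m _ _; rewrite lee_fin mulr_ge0// invr_ge0 powR_ge0.
apply: nearW => n; rewrite sumEFin lee_fin.
apply: (@le_trans _ _ (\sum_(0 <= m < n) c / d * (f m - f m.+1))).
  by apply: ler_sum => m _; exact: step.
rewrite -mulr_sumr -[leRHS]mulr1 ler_wpM2l ?divr_ge0 ?(ltW d0)//.
have -> : \sum_(0 <= m < n) (f m - f m.+1) = f 0%N - f n.
  rewrite -[RHS]opprB -(telescope_sumr _ (leq0n n)) -sumrN.
  by apply: eq_bigr => m _; rewrite opprB.
by rewrite /f powR1 invr1 lerBlDr lerDl invr_ge0 powR_ge0.
Qed.

(** The interval of radius [l] about any point of [A] will do, so [A] itself need not be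
    measurable. *)
Lemma small_diam_cover (R : realType) (A : set R) (l : R) : 0 <= l ->
  (forall s t, A s -> A t -> s <= t -> t - s <= l) ->
  exists J : set R, [/\ measurable J, A `<=` J &
     (@lebesgue_measure R J <= (2 * l)%:E)%E].
Proof.
move=> l0 dA; have [->|/set0P[s As]] := eqVneq A set0.
  by exists set0; split => //; rewrite measure0 lee_fin mulr_ge0.
exists `[s - l, s + l]%classic; split; first exact: measurable_itv.
  move=> t At /=; rewrite in_itv/=.
  have [st|/ltW ts] := leP s t; first by have := dA _ _ As At st; lra.
  by have := dA _ _ At As ts; lra.
rewrite lebesgue_measure_itv/= lte_fin; case: ifPn => _.
  by rewrite -EFinB lee_fin; lra.
by rewrite lee_fin mulr_ge0.
Qed.

(** The cap [T] on the exponent keeps ln (n / m) away from 0: (n / m)^t >= (1 + a)/2 then gives ln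
    (n / m) >= ln ((1 + a)/2) / T. *)
Definition small_form (R : realType) (a K d T : R) (m n : nat) : set R :=
  [set t | 2 + d <= t <= T /\ `|powR_form a m%:R n%:R t| <= K].

(** Put ro = n / m. Dividing by m^t gives |ro^t - a| <= K m^-(2+d) on the whole set, so two values
    of ro^t differ by at most 2K m^-(2+d), whereas ro^t grows at rate at least ln ro >= l. Also ro
    <= ro^t <= 2a. *)
Lemma small_form_bound (R : realType) (a K d T : R) : 1 < a -> 0 < K -> 0 < d -> 0 < T ->
  exists N : nat, exists2 C : R, 0 < C & forall m n : nat,
   (N <= m)%N -> (0 < m)%N -> (0 < n)%N ->
   (forall t, small_form a K d T m n t -> n%:R <= 2 * a * m%:R) /\
   (forall s t, small_form a K d T m n s -> small_form a K d T m n t -> s <= t ->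
       t - s <= C * (m%:R `^ (2 + d))^-1).
Proof.
move=> a1 K0 d0 T0.
have [N NP] := near_natR (2 * K / (a - 1)).
have [l lE] : exists l, l = ln ((1 + a) / 2) / T by eexists.
have l0 : 0 < l by rewrite lE divr_gt0// ln_gt0; lra.
exists N, (2 * K / l); first by rewrite divr_gt0//; lra.
move=> m n Nm m0 n0.
have := NP m Nm.
have : 1 <= m%:R :> R by rewrite ler1n.
have : 0 < n%:R :> R by rewrite ltr0n.
rewrite /small_form; move: m%:R n%:R => M M' M'0 M1; clear m n Nm m0 n0 NP.
move=> NM.
have Mp : 0 < M by lra.
have KM : K / M <= (a - 1) / 2.
  rewrite ler_pdivrMr//; move: NM; rewrite ler_pdivrMr; lra.
pose ro := M' / M.
have rop : 0 < ro by rewrite divr_gt0.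
have H t : 2 + d <= t -> `|powR_form a M M' t| <= K ->
    [/\ `|ro `^ t - a| <= K * (M `^ (2 + d))^-1, (1 + a) / 2 <= ro `^ t <= 2 * a & 1 <= ro].
  move=> dt.
  have Mt : M `^ (2 + d) <= M `^ t by exact: ler_powR.
  have Mt0 := powR_gt0 t Mp; have Md0 := powR_gt0 (2 + d) Mp.
  rewrite powR_form_ratio// normrM gtr0_norm// -/ro => h.
  have h1 : `|ro `^ t - a| <= K * (M `^ (2 + d))^-1.
    apply: (@le_trans _ _ (K * (M `^ t)^-1)).
      by rewrite ler_pdivlMr// mulrC.
    by rewrite ler_pM2l// lef_pV2 ?posrE.
  have h2 : K * (M `^ (2 + d))^-1 <= (a - 1) / 2.
    rewrite (le_trans _ KM)// ler_pM2l// lef_pV2 ?posrE//.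
    by rewrite le1r_powR//; lra.
  have h3 : (1 + a) / 2 <= ro `^ t <= 2 * a.
    by move: (le_trans h1 h2); rewrite ler_norml => /andP[? ?]; apply/andP; split; lra.
  split => //; rewrite leNgt; apply/negP => r1.
  have : ro `^ t <= ro `^ 0 by rewrite ger_powR//; [rewrite rop ltW|lra].
  by rewrite powRr0; move: h3 => /andP[? ?]; lra.
split=> [t [/andP[t1 t2] h]|s t [/andP[s1 s2] hs] [/andP[t1 t2] ht] st].
  have [_ /andP[_ roa] ro1] := H t t1 h.
  rewrite -ler_pdivrMr// (le_trans _ roa)// le1r_powR//; lra.
have [h1 /andP[h2 _] ro1] := H s s1 hs.
have [h3 _ _] := H t t1 ht.
have lro : l <= ln ro.
  rewrite lE ler_pdivrMr//; apply: (@le_trans _ _ (s * ln ro)).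
    by rewrite -ln_powR ler_ln ?posrE//; lra.
  by rewrite mulrC ler_wpM2l ?ln_ge0.
have E : ro `^ t - ro `^ s = ro `^ s * (expR ((t - s) * ln ro) - 1).
  by rewrite !powRE// mulrBr -expRD mulr1; congr (expR _ - _); ring.
have e1 := expR_ge1Dx ((t - s) * ln ro).
have e2 : (t - s) * l <= ro `^ t - ro `^ s.
  rewrite E.
  have : (t - s) * l <= (t - s) * ln ro by rewrite ler_wpM2l// subr_ge0.
  have : 0 <= (t - s) * ln ro by rewrite mulr_ge0 ?subr_ge0// ln_ge0.
  by move: h2 e1; set e := expR _; nra.
rewrite mulrAC ler_pdivlMr//.
by move: h1 h3; rewrite !ler_norml => /andP[? ?] /andP[? ?]; lra.
Qed.

(** For each m only O(m) values of n occur, each with a set of measure O(m^-(2+d)); their union has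
    measure O(m^-(1+d)), which is summable. *)
Lemma negligible_frequently_small_form (R : realType) (a K d T : R) :
  1 < a -> 0 < K -> 0 < d -> 0 < T ->
  (@lebesgue_measure R).-negligible [set t | forall N : nat, exists m n : nat,
    [/\ (N <= m)%N, (0 < m)%N, (0 < n)%N & small_form a K d T m n t]].
Proof.
move=> a1 K0 d0 T0; have [N [C C0 H]] := small_form_bound a1 K0 d0 T0.
have covP (mn : nat * nat) : exists J : set R, [/\ measurable J,
    (N <= mn.1)%N -> (0 < mn.1)%N -> (0 < mn.2)%N -> small_form a K d T mn.1 mn.2 `<=` J &
    (@lebesgue_measure R J <= (2 * (C * (mn.1%:R `^ (2 + d))^-1))%:E)%E].
  have l0 : 0 <= C * (mn.1%:R `^ (2 + d))^-1.
    by rewrite mulr_ge0 ?invr_ge0 ?powR_ge0// ltW.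
  have [/and3P[h1 h2 h3]|nh] := boolP [&& (N <= mn.1)%N, (0 < mn.1)%N & (0 < mn.2)%N].
    have [_ dm] := H mn.1 mn.2 h1 h2 h3.
    by have [J [mJ AJ lJ]] := small_diam_cover l0 dm; exists J.
  (* Pairs below the threshold get the empty cover; they do not affect the upper limit of the
     sets. *)
  exists set0; split => //; last by rewrite measure0 lee_fin mulr_ge0.
  by move=> h1 h2 h3; rewrite h1 h2 h3 in nh.
have [J HJ] := choice covP.
pose Pm (m : nat) := (Num.truncn (2 * a * m.+2%:R)).+1.
(* The index is shifted by 2 to match [nneseries_powR_lty]; [Pm m] exceeds every n <= 2a(m + 2). *)
pose F (m : nat) : set R := \big[setU/set0]_(n < Pm m) J (m.+2, n : nat).
have mF m : measurable (F m).
  by apply: bigsetU_measurable => n _; have [] := HJ (m.+2, n : nat).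
have Fle m : (lebesgue_measure (F m) <=
    ((2 * a + 1) * 2 * C * (m.+2%:R `^ (1 + d))^-1)%:E)%E.
  have subadd := @Boole_inequality _ _ _ (@lebesgue_measure R)
    (fun n => J (m.+2, n)) (Pm m).
  apply: (le_trans (subadd _)) => /=.
    by move=> n _; have [] := HJ (m.+2, n : nat).
  apply: (@le_trans _ _ (\sum_(n < Pm m) (2 * (C * (m.+2%:R `^ (2 + d))^-1))%:E)%E).
    by apply: lee_sum => n _; have [] := HJ (m.+2, n : nat).
  rewrite sumEFin lee_fin sumr_const card_ord -[leLHS]mulr_natl.
  set x : R := m.+2%:R.
  have x1 : 1 <= x by rewrite ler1n.
  have x0 : 0 < x by lra.
  have Px : (Pm m)%:R <= (2 * a + 1) * x.
    rewrite /Pm -[(Num.truncn _).+1%:R]natr1 [leRHS]mulrDl mul1r lerD//.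
    by have /andP[] := truncn_itv (mulr_ge0 (mulr_ge0 (ler0n R 2) (ltW (lt_trans ltr01 a1))) (ltW x0)).
  have -> : x `^ (2 + d) = x * x `^ (1 + d).
    have -> : 2 + d = 1 + (1 + d) by ring.
    by rewrite [LHS]powRD ?powRr1 ?(ltW x0)//; apply/implyP; rewrite (gt_eqF x0).
  have xd0 := powR_gt0 (1 + d) x0.
  have -> : (2 * a + 1) * 2 * C * (x `^ (1 + d))^-1 =
     ((2 * a + 1) * x) * (2 * (C * (x * x `^ (1 + d))^-1)).
    by field; rewrite !gt_eqF.
  by rewrite ler_wpM2r// !mulr_ge0 ?invr_ge0 ?mulr_ge0// ltW.
have F0 : lebesgue_measure (lim_sup_set F) = 0%E.
  apply: lim_sup_set_cvg0 => //.
  have c0 : 0 <= (2 * a + 1) * 2 * C by rewrite !mulr_ge0//; lra.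
  apply: le_lt_trans (nneseries_powR_lty d0 c0).
  by apply: lee_nneseries => // m _; exact: Fle.
exists (lim_sup_set F); split => //.
  by apply: bigcap_measurable => // k _; apply: bigcup_measurable => j _; exact: mF.
move=> t Ht k _ /=.
have [m [n [km m0 n0 tmn]]] := Ht (N + k + 2)%N.
have Nm : (N <= m)%N by clear - km; lia.
have m2 : (m - 2).+2 = m by clear - km; lia.
exists (m - 2)%N; first by rewrite /=; clear - km; lia.
have [nle _] := H m n Nm m0 n0.
have nP : (n < Pm (m - 2))%N.
  rewrite /Pm m2 ltnS truncn_ge_nat ?(nle t)//.
  by rewrite !mulr_ge0//; lra.
rewrite /F -(bigcup_mkord _ (fun n => J ((m - 2).+2, n))); exists n => //=; rewrite m2.
by have [_ + _] := HJ (m, n); apply.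
Qed.

(** The fractional parts of n^t and m^t move the value away from b by an amount between -a and 1. *)
Lemma PS_form_bound (R : realType) (a b t : R) (m n : nat) : 0 < a ->
  (Num.floor (n%:R `^ t))%:~R = a * (Num.floor (m%:R `^ t))%:~R + b ->
  `|powR_form a m%:R n%:R t| <= `|b| + a + 1.
Proof.
move=> a0 E.
have := floor_itv (n%:R `^ t); rewrite intrD E => /andP[n1 n2].
have := floor_itv (m%:R `^ t); rewrite intrD => /andP[m1 m2].
rewrite /powR_form ler_norml.
have := ler_norm b; have := ler_norm (- b); rewrite normrN => b1 b2.
by apply/andP; split; nra.
Qed.

Lemma negligible_gt2 (R : realType) (a b : R) : 1 < a ->
  (@lebesgue_measure R).-negligible
    [set t | 2 < t /\ ~ finite_set (line_solutions a b (PS t))].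
Proof.
move=> a1; have a0 : 0 < a by lra.
pose K := `|b| + a + 1.
have K0 : 0 < K by have := normr_ge0 b; rewrite /K; lra.
(* The intervals [2 + 1/(k+1), k + 3] exhaust ]2, +oo[, so countably many null sets suffice. *)
pose E (k : nat) := [set t : R | forall N : nat, exists m n : nat,
    [/\ (N <= m)%N, (0 < m)%N, (0 < n)%N & small_form a K k.+1%:R^-1 k.+3%:R m n t]].
have nE k : (@lebesgue_measure R).-negligible (E k).
  by apply: negligible_frequently_small_form => //; rewrite ?invr_gt0.
apply: negligibleS (negligible_bigcup nE) => t [t2 tinf].
apply: contrapT => tE; apply: tinf.
have [k1 k1P] := near_natR ((t - 2)^-1).
have [k2 k2P] := near_natR t.
pose k := (k1 + k2)%N.
have kt1 : 2 + k.+1%:R^-1 <= t.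
  rewrite -lerBrDl -[leRHS]invrK lef_pV2 ?posrE ?invr_gt0 ?subr_gt0//.
  by apply: k1P; rewrite /k; lia.
have kt2 : t <= k.+3%:R by apply: k2P; rewrite /k; lia.
have : ~ E k t by move=> Ekt; apply: tE; exists k.
move=> /existsNP[N HN].
have HmN (m n : nat) : (0 < m)%N -> (0 < n)%N ->
    (Num.floor (n%:R `^ t))%:~R = a * (Num.floor (m%:R `^ t))%:~R + b -> (m < N)%N.
  move=> m0 n0 mn; rewrite ltnNge; apply/negP => Nm; apply: HN.
  exists m, n; split => //; split; first by rewrite kt1.
  exact: PS_form_bound.
(* A solution is determined by its x, hence by m; with m < N only finitely many remain. *)
pose g (m : nat) : int * int := (Num.floor (m%:R `^ t : R),
   Num.floor (a * (Num.floor (m%:R `^ t : R))%:~R + b)).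
apply: (@sub_finite_set _ _ (g @` `I_N)); last exact: finite_image (finite_II N).
move=> [x y] [/= [m m0 mx] [n n0 ny] xy].
exists m; first by apply: (HmN m n) => //; rewrite mx ny.
by rewrite /g mx -xy intrKfloor.
Qed.

(** * Exponents below 2: conclusion *)

(** Porosity is used twice: on all of ]1, 2[ for [near_line], then for [floor_line] on the set [S]
    of points that pass the first stage for every N. Taking interiors makes [S] measurable. *)
Lemma negligible_lt2 (R : realType) (a b : R) (q x0 : int) : 1 < a -> 0 < q ->
  (@lebesgue_measure R).-negligible
    [set t | 1 < t < 2 /\ ~ forall N, floor_line a b q x0 N t].
Proof.
move=> a1 q0; pose I : set R := `]1, 2[%classic.
have mI : measurable I by exact: measurable_itv.
pose S : set R := I `&` \bigcap_N (near_line a b N)°.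
have mS : measurable S.
  apply: measurableI => //; apply: bigcap_measurable => // N _.
  by apply: measurable_realfun.open_measurable; exact: open_interior.
have n1 N : (@lebesgue_measure R).-negligible (I `\` (near_line a b N)°).
  apply: negligible_porous => // t; rewrite /I/= in_itv/= => t12.
  exact: near_line_porous.
have n2 N : (@lebesgue_measure R).-negligible (S `\` (floor_line a b q x0 N)°).
  apply: negligible_porous => // t [+ tS]; rewrite /I/= in_itv/= => t12.
  apply: floor_line_porous => // N'; apply: interior_subset; exact: tS.
apply: negligibleS (negligibleU (negligible_bigcup n1) (negligible_bigcup n2)).
move=> t [t12 nfl]; have It : I t by rewrite /I/= in_itv.
have [St|nSt] := pselect (S t).
  right; apply: contrapT => h; apply: nfl => N; apply: interior_subset.
  by apply: contrapT => hN; apply: h; exists N.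
left; apply: contrapT => h; apply: nSt; split => // N _.
by apply: contrapT => hN; apply: h; exists N.
Qed.

(** Finitely many solutions would have |x| < B for some B, but m >= B + 1 yields a solution with x
    >= m^t - 1/(4a) > B. *)
Lemma infinite_line_solutions_PS (R : realType) (a b t : R) (q x0 : int) :
  1 < a -> 1 < t -> (forall x, (q %| x - x0)%Z -> exists y : int, y%:~R = a * x%:~R + b) ->
  (forall N, floor_line a b q x0 N t) -> infinite_set (line_solutions a b (PS t)).
Proof.
move=> a1 t1 qP fl fin.
have [B HB] : exists B : nat, forall p, line_solutions a b (PS t) p -> (`|p.1| < B)%N.
  have := finite_image (fun p : int * int => `|p.1|%N) fin.
  move=> /finite_seqP[s sE]; exists (\max_(i <- s) i).+1 => p pS.
  rewrite ltnS; apply: (@leq_bigmax_seq _ s xpredT id) => //.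
  have : [set` s] `|p.1|%N by rewrite -sE; exists p.
  by [].
have [m [n [x [Bm m0 n0 qx [/andP[mx1 mx2] /andP[h1 h2]]]]]] := fl B.+1.
have [y yE] := qP x qx.
have e4 : (4 * a)^-1 < 1 by rewrite invf_lt1; lra.
(* The error of m^t costs at most 1/4 and that of h at most 1/2, so n^t lies in [y, y + 3/4]. *)
have ae : a * (4 * a)^-1 = 4^-1 by field; lra.
have mxE : Num.floor (m%:R `^ t : R) = x.
  by apply: floor_def; rewrite intrD mx1/=; lra.
have nyE : Num.floor (n%:R `^ t : R) = y.
  have nE : n%:R `^ t = a * m%:R `^ t + powR_form a m%:R n%:R t.
    by rewrite /powR_form; ring.
  have a2 : a * x%:~R <= a * m%:R `^ t by rewrite ler_wpM2l//; lra.
  have a3 : a * m%:R `^ t <= a * x%:~R + 4^-1.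
    by rewrite -ae -mulrDr ler_wpM2l//; lra.
  by apply: floor_def; rewrite intrD yE nE; apply/andP; split; lra.
have : (`|(x, y).1| < B)%N.
  by apply: HB; split => /=; [exists m|exists n|].
rewrite /= ltnNge => /negP; apply.
have mt : m%:R <= m%:R `^ t :> R by rewrite le1r_powR ?ler1n// ltW.
have mR : B%:R + 1 <= m%:R :> R by rewrite natr1 ler_nat.
have : (Posz B)%:~R <= x%:~R :> R by rewrite -pmulrn; lra.
by rewrite ler_int; clear; lia.
Qed.

(** * Slopes greater than 1, and the reduction to them *)

Lemma ae_line_solutions_PS_gt1 (R : realType) (a b : R) : 1 < a ->
  infinite_set (line_solutions a b posint) ->
  {ae (@lebesgue_measure R), forall t : R, 1 < t ->
    (t < 2 -> infinite_set (line_solutions a b (PS t))) /\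
    (2 < t -> finite_set (line_solutions a b (PS t)))}.
Proof.
move=> a1 infN.
(* Two distinct solutions have distinct x. The modulus is |x2 - x1|, and x1 + k (x2 - x1) is sent to
   the integer y1 + k (y2 - y1). *)
have [q [x0 [q0 qP]]] : exists q x0 : int, 0 < q /\
    forall x, (q %| x - x0)%Z -> exists y : int, y%:~R = a * x%:~R + b.
  have [[x1 y1] [/= _ _ E1]] := infinite_setN0 infN.
  have [[x2 y2] [/= [_ _ E2] /eqP ne]] := infinite_setN0 (infinite_setD infN (finite_set1 (x1, y1))).
  rewrite /= in E2.
  have x12 : x2 - x1 != 0.
    rewrite subr_eq0; apply: contra ne => /eqP x12; apply/eqP.
    congr (_, _) => //; apply: (@mulrIz R 1 (oner_neq0 R)).
    by rewrite E1 E2 x12.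
  exists `|x2 - x1|, x1; split; first by rewrite normr_gt0.
  move=> x; rewrite dvdzE -abszE -[(_ %| _)%N]/(x2 - x1 %| x - x1)%Z => /dvdzP[k xE].
  exists (y1 + k * (y2 - y1)).
  have -> : x = x1 + k * (x2 - x1) by rewrite -xE addrC subrK.
  by rewrite !(rmorphD, rmorphM, rmorphN)/= E1 E2; ring.
apply: negligibleS (negligibleU (negligible_gt2 b a1) (negligible_lt2 b x0 a1 q0)).
move=> t /= /not_implyP[t1 /not_andP[/not_implyP[t2 nf]|/not_implyP[t2 nf]]].
  right; split; first by rewrite t1.
  by move=> fl; apply: nf; exact: (infinite_line_solutions_PS a1 t1 qP).
by left.
Qed.

Definition swap_pair (T : Type) (p : T * T) := (p.2, p.1).

Lemma line_solutions_swap (R : realType) (a b : R) (A : set int) : a != 0 ->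
  line_solutions a b A = @swap_pair int @` line_solutions a^-1 (- b / a) A.
Proof.
move=> a0; apply/seteqP; split => [[x y] [/= Ax Ay E]|_ [[y x] [/= Ay Ax E] <-]].
  by exists (y, x) => //; split => //=; rewrite E; field.
by split => //=; rewrite E; field.
Qed.

Lemma finite_line_solutions_swap (R : realType) (a b : R) (A : set int) : a != 0 ->
  finite_set (line_solutions a b A) <-> finite_set (line_solutions a^-1 (- b / a) A).
Proof.
move=> a0; split => [|fin]; last by rewrite line_solutions_swap//; exact: finite_image.
rewrite [X in _ -> finite_set X]line_solutions_swap ?invr_eq0//.
have -> : - (- b / a) / a^-1 = b by field.
by rewrite invrK => fin; exact: finite_image.
Qed.

(** With a negative slope, y > 0 forces x < -b/a, leaving finitely many x. *)
Lemma infinite_posint_slope_gt0 (R : realType) (a b : R) : a != 0 ->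
  infinite_set (line_solutions a b posint) -> 0 < a.
Proof.
move=> a0 inf; rewrite lt0r a0/= leNgt; apply/negP => an; apply: inf.
have [N HN] := near_natR (- b / a).
pose g (m : nat) : int * int := (m%:Z, Num.floor (a * m%:R + b)).
apply: (@sub_finite_set _ _ (g @` `I_N)); last exact: finite_image (finite_II N).
move=> [x y] [/= [m m0 mx] [n n0 ny] xy].
have xE : a * m%:R + b = y%:~R by rewrite xy -mx -pmulrn.
exists m; last by rewrite /g xE mx intrKfloor.
rewrite /= ltnNge; apply/negP => /HN.
rewrite ler_ndivrMr// => h.
have : 0 < y%:~R :> R by rewrite -ny -pmulrn ltr0n.
by rewrite -xE; lra.
Qed.

Theorem theorem1p2 (R : realType) (a b : R) (a_neq0 : a <> 0) (a_neq1 : a <> 1)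
  (infN : infinite_set (line_solutions a b posint)) :
  {ae (@lebesgue_measure R), forall alpha : R, 1 < alpha ->
    (alpha < 2 -> infinite_set (line_solutions a b (PS alpha))) /\
    (2 < alpha -> finite_set (line_solutions a b (PS alpha)))}.
Proof.
have a0 : a != 0 by apply/eqP.
have ap := infinite_posint_slope_gt0 a0 infN.
have [a1|a1|//] := ltgtP a 1; last exact: ae_line_solutions_PS_gt1.
(* For 0 < a < 1 the coordinates are exchanged, giving a line of slope 1/a > 1. *)
have inf' : infinite_set (line_solutions a^-1 (- b / a) posint).
  by move=> fin; apply: infN; apply/finite_line_solutions_swap.
have ai1 : 1 < a^-1 by rewrite invf_gt1.
apply: negligibleS (ae_line_solutions_PS_gt1 ai1 inf') => t; apply: contra_not => H t1.
have [H1 H2] := H t1; split=> [t2 fin|t2].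
  by apply: (H1 t2); apply/(finite_line_solutions_swap b _ a0).
by apply/(finite_line_solutions_swap b _ a0); exact: H2.
Qed.
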